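(* For every integer $\Delta\ge 0$ there exist constants $c,C>0$ and $n_0$, depending only on $\Delta$, such that the following holds. Let $G=(V,E)$ be any vertex-transitive graph with $n=|V|\ge n_0$ vertices and maximum degree at most $\Delta$. Then the maximum load $X_{\max}^{(n)}$ after $n$ balls have been allocated by the local search allocation on $G$ satisfies $$\mathbf{Pr}\left[\, c\,R_1(G)\le X_{\max}^{(n)}\le C\,R_1(G)\,\right]\ge 1-n^{-1},$$ i.e. with probability at least $1-n^{-1}$ the maximum load after $n$ balls is $\Theta(R_1)$.
   Context: Graphs are finite and undirected, not necessarily connected. $d_G(u,v)$ is the graph distance ($\infty$ if $u,v$ lie in different components) and $B_u^r=\{v\in V: d_G(u,v)\le r\}$. With $\mathbb{N}=\{1,2,\dots\}$ and $\log$ the natural logarithm, define $$R_1(G)=\min\{r\in\mathbb{N}: r\,|B_u^r|\log r\ge \log n\ \text{for all } u\in V\}.$$ Local search allocation on $G$: initially all vertices have load $0$. Balls $1,2,\dots$ arrive one at a time. Ball $i$ is born at a vertex $U_i$ (its birthplace) chosen independently and uniformly at random from $V$. Starting at its birthplace, in each step the ball moves to a neighbour of its current vertex having the smallest load among all neighbours, provided that this load is strictly smaller than the load of the current vertex; ties between smallest-load neighbours are broken independently and uniformly at random. The ball stops at the first vertex visited that has no neighbour of strictly smaller load, and it is allocated there, increasing that vertex's load by $1$. Then the next ball arrives. $X_v^{(m)}$ denotes the load of $v$ after $m$ balls have been allocated, and $X_{\max}^{(m)}=\max_{v\in V}X_v^{(m)}$. *)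

(* Defs.v *)
From HB Require Import structures.
From mathcomp Require Import all_boot all_order all_fingroup all_algebra.
From mathcomp Require Import reals exp.
Set Implicit Arguments.
Unset Strict Implicit.
Unset Printing Implicit Defensive.
Import Order.TTheory GRing.Theory Num.Theory.
Local Open Scope ring_scope.

(* A graph is given by its adjacency relation [e : rel T] on a finite type;   *)
(* symmetry and irreflexivity are hypotheses of the theorem.                  *)

Section Graph.
Variables (T : finType) (e : rel T).

Definition neighbours (v : T) : {set T} := [set w | e v w].

Definition max_degree : nat := (\max_(v : T) #|neighbours v|)%N.

Definition automorphism (s : {perm T}) : Prop :=
  forall x y, e (s x) (s y) = e x y.

Definition vertex_transitive : Prop :=
  forall u v, exists2 s : {perm T}, automorphism s & s u = v.

Definition path_of_length (u v : T) (k : nat) : bool :=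
  [exists p : k.-tuple T, path e u p && (last u p == v)].

(* [None] stands for an infinite distance. Searching the lengths 0, ..., n - 1 *)
(* is enough, because a shortest path does not repeat vertices.               *)
Definition gdist (u v : T) : option nat :=
  let k := find (path_of_length u v) (iota 0 #|T|) in
  if (k < #|T|)%N then Some k else None.

Definition gball (u : T) (r : nat) : {set T} :=
  [set v | if gdist u v is Some k then (k <= r)%N else false].

Lemma gballP u v r :
  reflect (exists p, [/\ path e u p, last u p = v & (size p <= r)%N])
          (v \in gball u r).
Proof.
rewrite inE /gdist; set k := find _ _.
have nthk : (k < #|T|)%N -> nth 0%N (iota 0 #|T|) k = k.
  by move=> lt; rewrite nth_iota.
apply: (iffP idP).
  case: ifP => // lt_k le_kr.
  have := nth_find 0%N (a := path_of_length u v) (s := iota 0 #|T|).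
  rewrite has_find size_iota -/k => /(_ lt_k); rewrite nthk //.
  by case/existsP=> p /andP[pp /eqP pl]; exists p; rewrite size_tuple.
case=> p0 [pp0]; case/shortenP: (pp0) => p pp up sub pl le_p.
have lt_p : (size p < #|T|)%N by have := max_card (mem (u :: p)); rewrite (card_uniqP up).
have le_r : (size p <= r)%N.
  by apply: leq_trans le_p; apply: uniq_leq_size => //; case/andP: up.
have le_k : (k <= size p)%N.
  rewrite leqNgt; apply/negP => lt.
  have := before_find 0%N lt; rewrite nth_iota // add0n.
  case/existsP; exists (in_tuple p); by rewrite pp /= pl.
by rewrite (leq_ltn_trans le_k lt_p) (leq_trans le_k).
Qed.

Lemma gball_center u r : u \in gball u r.
Proof. by apply/gballP; exists [::]. Qed.

Section R1.
Variable R : realType.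

Definition R1_admissible (r : nat) : bool :=
  (0 < r)%N &&
  [forall u : T, ln (#|T|%:R : R) <= r%:R * #|gball u r|%:R * ln (r%:R : R)].

Lemma R1_exists : exists r, R1_admissible r.
Proof.
exists #|T|.+1; apply/andP; split=> //; apply/forallP => u.
have T0 : (0 < #|T|)%N by apply/card_gt0P; exists u.
have le1 : ln (#|T|%:R : R) <= ln (#|T|.+1%:R : R).
  by rewrite ler_ln ?posrE ?ltr0n // ler_nat.
apply: le_trans le1 _; apply: ler_peMl; first by rewrite ln_ge0 // ler1n.
rewrite -natrM ler1n muln_gt0 /=.
by apply/card_gt0P; exists u; apply: gball_center.
Qed.

Definition R1 : nat := ex_minn R1_exists.

End R1.
End Graph.

Section LocalSearch.
Variables (R : realType) (T : finType) (e : rel T).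

(* The places a ball at [v] may move to when the loads are [x]; this set is   *)
(* empty exactly when no neighbour of [v] has a strictly smaller load.        *)
Definition next_places (x : T -> nat) (v : T) : {set T} :=
  [set w in neighbours e v |
    [forall z in neighbours e v, (x w <= x z)%N] && (x w < x v)%N].

(* Probability that a ball now at [v] is at [w] after at most [k] moves, where *)
(* each move is to a uniformly random element of [next_places x v].           *)
Fixpoint search_prob (k : nat) (x : T -> nat) (v w : T) : R :=
  let S := next_places x v in
  if k is k'.+1 then
    if S == set0 then (v == w)%:R
    else #|S|%:R^-1 * \sum_(z in S) search_prob k' x z w
  else (v == w)%:R.

(* Every move strictly decreases the load of the current vertex, so a ball    *)
(* born at [u] has stopped after at most [x u] moves.                         *)
Definition alloc_prob (x : T -> nat) (u w : T) : R := search_prob (x u) x u w.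

Lemma next_places_lt x v w : w \in next_places x v -> (x w < x v)%N.
Proof. by rewrite inE => /and3P[]. Qed.

Lemma next_places_eq0 x v :
  (next_places x v == set0) = [forall w in neighbours e v, (x v <= x w)%N].
Proof.
apply/eqP/forall_inP => [S0 w vw | H].
  case: (arg_minnP x vw) => z vz minz; apply: leq_trans (minz _ vw).
  rewrite leqNgt; apply/negP => lt_zv.
  suff: z \in next_places x v by rewrite S0 inE.
  by rewrite inE lt_zv andbT; apply/andP; split=> //; apply/forall_inP.
apply/setP => w; rewrite !inE; apply/negP => /and3P[vw _].
by rewrite ltnNge H // inE.
Qed.

Lemma search_prob_stable k x v w :
  (x v <= k)%N -> search_prob k x v w = alloc_prob x v w.
Proof.
rewrite /alloc_prob; have [n le_n] := ubnP (x v).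
elim: n v k w le_n => // n IH v k w; rewrite ltnS => le_n le_k.
case: (eqVneq (next_places x v) set0) => [S0|nS0].
  by case: k le_k => [|k] _; case: (x v) => [|j] /=; rewrite ?S0 ?eqxx.
have [z0 /next_places_lt lt0] := set0Pn _ nS0.
case: k le_k => [|k] le_k; first by rewrite leqNgt (leq_ltn_trans _ lt0) in le_k.
case Ev: (x v) le_k lt0 le_n => [|j] // le_k _ le_n.
rewrite /= (negPf nS0); congr (_ * _); apply: eq_bigr => z /next_places_lt.
rewrite Ev ltnS => le_z.
by rewrite !IH ?(leq_trans le_z) // (leq_ltn_trans le_z).
Qed.

Lemma alloc_prob_sum x u : \sum_w alloc_prob x u w = 1.
Proof.
rewrite /alloc_prob; have dirac v : \sum_w (v == w)%:R = 1 :> R.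
  rewrite (bigD1 v) //= eqxx big1 ?addr0 // => w nw.
  by rewrite eq_sym (negPf nw).
move: (x u) => k; elim: k u => [|k IH] v /=; first exact: dirac.
case: eqP => [_|/eqP nS0]; first exact: dirac.
rewrite -big_distrr exchange_big /= (eq_bigr (fun=> 1)) => [|z _]; last exact: IH.
by rewrite sumr_const mulVf // pnatr_eq0 cards_eq0.
Qed.

(* An outcome of the first [m] balls lists, ball by ball, the pair            *)
(* (birthplace, vertex where the ball is allocated).                          *)
Definition load (h : seq (T * T)) (v : T) : nat := count_mem v (unzip2 h).

Definition max_load (h : seq (T * T)) : nat := (\max_(v : T) load h v)%N.

Definition outcome_prob (m : nat) (h : m.-tuple (T * T)) : R :=
  \prod_(i < m) (#|T|%:R^-1 *
    alloc_prob (load (take i h)) (tnth h i).1 (tnth h i).2).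

Definition Prob (m : nat) (A : pred (m.-tuple (T * T))) : R :=
  \sum_(h | A h) outcome_prob h.

Lemma Prob_total m : (0 < #|T|)%N -> Prob (m := m) predT = 1.
Proof.
move=> T0; rewrite /Prob; elim: m => [|m IH].
  rewrite (bigD1 [tuple]) //= big1 => [|h /eqP[]]; last exact: tuple0.
  by rewrite /outcome_prob big_ord0 addr0.
pose f (q : m.-tuple (T * T) * (T * T)) : m.+1.-tuple (T * T) :=
  [tuple of rcons q.1 q.2].
have valf q : val (f q) = rcons q.1 q.2 by [].
have f_bij : bijective f.
  apply: inj_card_bij => [[h p] [h' p'] /(congr1 val)|].
    by rewrite !valf => /rcons_inj[/val_inj -> ->].
  by rewrite card_prod !card_tuple expnSr.
rewrite (reindex f) /=; last exact: onW_bij.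
rewrite -(pair_bigA _ (fun h p => outcome_prob (f (h, p)))) /= -[RHS]IH.
apply: eq_bigr => h _.
have E p : outcome_prob (f (h, p)) =
    outcome_prob h * (#|T|%:R^-1 * alloc_prob (load h) p.1 p.2).
  rewrite /outcome_prob big_ord_recr /=; congr (_ * _).
    apply: eq_bigr => i _.
    rewrite !(tnth_nth p) valf /= nth_rcons size_tuple ltn_ord.
    by rewrite -cats1 takel_cat // size_tuple ltnW.
  rewrite (tnth_nth p) valf /= nth_rcons size_tuple ltnn eqxx.
  by rewrite -cats1 take_size_cat ?size_tuple.
rewrite (eq_bigr _ (fun p _ => E p)) -big_distrr /=.
rewrite -(pair_bigA _ (fun u w => #|T|%:R^-1 * alloc_prob (load h) u w)) /=.
rewrite (eq_bigr (fun=> #|T|%:R^-1)) => [|u _].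
  by rewrite sumr_const -[X in _ * X]mulr_natr mulVf ?mulr1 // pnatr_eq0 -lt0n.
by rewrite -big_distrr /= alloc_prob_sum mulr1.
Qed.

End LocalSearch.

(* Main.v *)
(* Upper bound. A ball born at [u] that lands at [w] on height [j] passes     *)
(* through strictly decreasing loads, so [u] has load at least                *)
(* [j - 1 + dist u w]. Fix a vertex [v] and give a ball at [w] on height [j]  *)
(* a value that is nondecreasing in [j - dist v w]: then a ball is worth at   *)
(* most as much as if it had stayed on top of its birthplace. If the value is *)
(* 1 above the cone [j = h0 + dist v w] and decays like [b^(-depth)] below    *)
(* it, the total value grows in unit time at a rate of at most [b - 1] times  *)
(* itself, which controls its exponential moments. Loads of neighbours differ *)
(* by at most 1, so a load of order [s] at [v] puts order [s * |B_s|] balls   *)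
(* above the cone. If [|B_8s| <= s * |B_s|], the ratio [b = 1 + s^(-1/2)]     *)
(* bounds the probability of this by about [exp(- s |B_s| ln s / 12)];        *)
(* otherwise a constant ratio at a larger radius loses only the logarithm,    *)
(* and the growth of the balls compensates for that.                          *)
(*                                                                            *)
(* Lower bound. If the maximum load stays below [l], no ball travels further  *)
(* than [l], so fewer than [l * |B_(s+l)|] balls are born in each ball of     *)
(* radius [s]. With [l] of order [R1 - 1], which is not admissible, some      *)
(* [s <= l] makes a given ball of radius [s] violate this with probability at *)
(* least [n^(-1/4)]; the occupation numbers of the many disjoint balls of     *)
(* radius [s] are negatively associated, so that one of them does.            *)

(* Each tail has probability at most [n^(-2)], and each is bounded through
   [Prob_le_supermartingale], by a function of the history and of the number of balls still to come.
   Two facts tie the process to the geometry. A move lowers the load by at least 1 and changes a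
   distance by at most 1 ([search_prob_lipschitz]), and a ball stops at a local minimum, so that
   loads are 1-Lipschitz ([load_lipschitz]). For the upper tail the function is a sum over apexes of
   exponentials of cone potentials, whose exponent shrinks over time to absorb their growth
   ([potential_step]). [Prob_max_load_ge] leaves the decay ratio free; a slow and a constant ratio
   cover moderate and fast volume growth. For the lower tail it is a product of binomial tails over
   a packing of disjoint balls, as if their birth counts were independent ([Prob_births_lt]). A
   small maximum load limits the births in every ball ([births_lt]), and [ex_concentrating_radius]
   finds a radius at which this is unlikely. Transitivity makes all balls of one radius equally
   large, so the failure of admissibility at one vertex is a failure everywhere. *)
Require Import Defs.
From HB Require Import structures.
From mathcomp Require Import all_boot all_order all_fingroup all_algebra.
From mathcomp Require Import reals exp.
From mathcomp Require Import sequences zify ring lra.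
Set Implicit Arguments.
Unset Strict Implicit.
Unset Printing Implicit Defensive.
Import Order.TTheory GRing.Theory Num.Theory.
Local Open Scope ring_scope.

(** * Histories of the process *)

Section Process.
Variables (R : realType) (T : finType) (e : rel T).
Implicit Types (h : seq (T * T)) (x : T -> nat).

(** Lipschitz loads and bounded travel hold only along such histories; all others have probability
    0. *)
Definition feasible h : Prop :=
  forall h1 p h2, h = h1 ++ p :: h2 -> alloc_prob R e (load h1) p.1 p.2 != 0.

Lemma feasible_rcons h p : feasible (rcons h p) <->
  feasible h /\ alloc_prob R e (load h) p.1 p.2 != 0.
Proof.
split=> [fh|[fh ap] h1 q h2]; first split=> [h1 q h2 eq_h|].
- by apply: (fh h1 q (rcons h2 p)); rewrite eq_h rcons_cat.
- by apply: (fh h p [::]); rewrite cats1.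
case/lastP: h2 => [|h2 q'].
  by rewrite cats1 => /rcons_inj[<- <-].
by rewrite -rcons_cons -rcons_cat => /rcons_inj[eq_h _]; apply: fh eq_h.
Qed.

Lemma outcome_prob_feasible m (h : m.-tuple (T * T)) :
  outcome_prob R e h != 0 -> feasible h.
Proof.
move=> /prodf_neq0 nz h1 p h2 eq_h.
have lt_m : (size h1 < m)%N.
  by rewrite -(size_tuple h) eq_h size_cat /= -[X in (X < _)%N]addn0 ltn_add2l.
have := nz (Ordinal lt_m) isT; rewrite mulf_eq0 negb_or => /andP[_] /=.
by rewrite (tnth_nth p) /= eq_h take_size_cat // nth_cat ltnn subnn.
Qed.

Lemma search_prob_ge0 k x u w : 0 <= search_prob R e k x u w.
Proof.
elim: k u => [|k IH] u /=; first by rewrite ler0n.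
case: ifP => _; first by rewrite ler0n.
by rewrite mulr_ge0 ?invr_ge0 ?ler0n // sumr_ge0.
Qed.

Lemma alloc_prob_ge0 x u w : 0 <= alloc_prob R e x u w.
Proof. exact: search_prob_ge0. Qed.

Lemma outcome_prob_ge0 m (h : m.-tuple (T * T)) : 0 <= outcome_prob R e h.
Proof.
by apply: prodr_ge0 => i _; rewrite mulr_ge0 ?invr_ge0 ?ler0n ?alloc_prob_ge0.
Qed.

Lemma outcome_prob_rcons m (h : m.-tuple (T * T)) p :
  outcome_prob R e [tuple of rcons h p] =
  outcome_prob R e h * (#|T|%:R^-1 * alloc_prob R e (load h) p.1 p.2).
Proof.
rewrite /outcome_prob big_ord_recr /=; congr (_ * _).
  apply: eq_bigr => i _.
  rewrite !(tnth_nth p) /= nth_rcons size_tuple ltn_ord.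
  by rewrite -cats1 takel_cat // size_tuple ltnW.
rewrite (tnth_nth p) /= nth_rcons size_tuple ltnn eqxx.
by rewrite -cats1 take_size_cat ?size_tuple.
Qed.

Lemma sum_rcons_tuple (S : finType) m (F : m.+1.-tuple S -> R) :
  \sum_q F q = \sum_(q : m.-tuple S) \sum_p F [tuple of rcons q p].
Proof.
pose f (q : m.-tuple S * S) : m.+1.-tuple S := [tuple of rcons q.1 q.2].
have f_bij : bijective f.
  apply: inj_card_bij => [[h p] [h' p'] /(congr1 val)|].
    by move=> /= /rcons_inj[/val_inj -> ->].
  by rewrite card_prod !card_tuple expnSr.
rewrite (reindex f); last exact: onW_bij.
by rewrite (pair_bigA _ (fun (q : m.-tuple S) p => F (f (q, p)))); apply: eq_bigr => -[].
Qed.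

(* [Phi k h] bounds the probability of [A] given the history [h] when [k]     *)
(* balls are still to come, so the bound is a backward induction over time.   *)
Lemma Prob_le_supermartingale m (A : pred (m.-tuple (T * T)))
    (Phi : nat -> seq (T * T) -> R) :
  (forall k h, 0 <= Phi k h) ->
  (forall h : m.-tuple (T * T), feasible h -> A h -> 1 <= Phi 0%N h) ->
  (forall k h, (k < m)%N -> feasible h ->
    #|T|%:R^-1 * \sum_u \sum_w
      alloc_prob R e (load h) u w * Phi k (rcons h (u, w)) <= Phi k.+1 h) ->
  Prob R e A <= Phi m [::].
Proof.
move=> Phi_ge0 final step.
have sumPhi j k : (j + k <= m)%N ->
    \sum_(h : j.-tuple (T * T)) outcome_prob R e h * Phi k h <=
    Phi (j + k)%N [::].
  elim: j k => [|j IH] k le_m.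
    rewrite (bigD1 [tuple]) //= big1 => [|h /eqP[]]; last exact: tuple0.
    by rewrite /outcome_prob big_ord0 mul1r addr0.
  rewrite addSnnS; rewrite addSnnS in le_m; apply: le_trans (IH _ le_m).
  rewrite sum_rcons_tuple; apply: ler_sum => h _.
  rewrite (eq_bigr (fun p => outcome_prob R e h * (#|T|%:R^-1 *
      (alloc_prob R e (load h) p.1 p.2 * Phi k (rcons h p))))); last first.
    by move=> p _; rewrite outcome_prob_rcons !mulrA.
  rewrite -big_distrr /=; have [->|nz] := eqVneq (outcome_prob R e h) 0.
    by rewrite !mul0r.
  apply: ler_wpM2l; first exact: outcome_prob_ge0.
  have lt_km : (k < m)%N.
    by apply: leq_trans le_m; rewrite leq_addl.
  apply: le_trans (step k h lt_km (outcome_prob_feasible nz)).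
  rewrite -big_distrr pair_bigA /=.
  by under [X in _ <= _ * X]eq_bigr => p do rewrite -surjective_pairing.
have := sumPhi m 0%N; rewrite addn0 => /(_ (leqnn m)); apply: le_trans.
rewrite /Prob big_mkcond; apply: ler_sum => h _; case: ifP => Ah; last first.
  by rewrite mulr_ge0 ?outcome_prob_ge0.
have [->|nz] := eqVneq (outcome_prob R e h) 0; first by rewrite mul0r.
rewrite ler_peMr ?outcome_prob_ge0 //.
by apply: final => //; apply: outcome_prob_feasible.
Qed.

(** Load minus [d] cannot increase along a move. This serves twice: with the distance to the apex of
    a cone, and with the distance to the landing place, which bounds the travel. *)
Lemma search_prob_lipschitz (d : T -> nat) k x u w :
  (forall y z, e y z -> (d y <= d z + 1)%N) ->
  search_prob R e k x u w != 0 -> (d u + x w <= d w + x u)%N.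
Proof.
move=> lip; elim: k u => [|k IH] u /=.
  by case: (eqVneq u w) => [->|] //; rewrite eqxx.
case: ifP => _; first by case: (eqVneq u w) => [->|] //; rewrite eqxx.
rewrite mulf_eq0 negb_or => /andP[_ nz].
have [z zS nzz] : exists2 z, z \in next_places e x u & search_prob R e k x z w != 0.
  apply/exists_inP; rewrite -[X in is_true X]negbK negb_exists_in.
  apply: contra nz => /forall_inP H; apply/eqP; apply: big1 => z zS.
  by apply/eqP; rewrite -[X in is_true X]negbK H.
have := IH _ nzz; have := next_places_lt zS; move: zS.
by rewrite !inE => /andP[/lip]; lia.
Qed.

Lemma search_prob_local_min k x u w : (x u <= k)%N ->
  search_prob R e k x u w != 0 -> forall z, e w z -> (x w <= x z)%N.
Proof.
elim: k u => [|k IH] u /=.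
  by rewrite leqn0 => /eqP xu0; case: (eqVneq u w) => [<-|] //; rewrite ?xu0 // eqxx.
move=> le_k; case: ifP => [S0|_].
  case: (eqVneq u w) => [<- _ z uz|]; last by rewrite eqxx.
  by move: S0; rewrite next_places_eq0 => /forall_inP; apply; rewrite inE.
rewrite mulf_eq0 negb_or => /andP[_ nz].
have [z zS nzz] : exists2 z, z \in next_places e x u & search_prob R e k x z w != 0.
  apply/exists_inP; rewrite -[X in is_true X]negbK negb_exists_in.
  apply: contra nz => /forall_inP H; apply/eqP; apply: big1 => z zS.
  by apply/eqP; rewrite -[X in is_true X]negbK H.
by apply: IH nzz; rewrite -ltnS (leq_trans _ le_k) // (next_places_lt zS).
Qed.

Lemma load_rcons h p w : load (rcons h p) w = (load h w + (p.2 == w))%N.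
Proof. by rewrite /load /unzip2 map_rcons -cats1 count_cat /= addn0. Qed.

(** The vertex whose load is raised was a local minimum, so it rises to at most 1 above each
    neighbour. *)
Lemma load_lipschitz h : symmetric e -> feasible h ->
  forall u w, e u w -> (load h u <= load h w + 1)%N.
Proof.
move=> esym; elim/last_ind: h => [|h p IH] // /feasible_rcons[fh ap] u w uw.
have := search_prob_local_min (leqnn _) ap; rewrite !load_rcons.
have := IH fh _ _ uw.
case: (eqVneq p.2 u) => [pu|_]; case: (eqVneq p.2 w) => _ //=; try lia.
by move=> _ /(_ w); rewrite pu => /(_ uw); lia.
Qed.

Lemma sum_load_le h (p : pred (T * T)) (S : {set T}) :
  (forall q, q \in h -> p q -> q.2 \in S) ->
  (count p h <= \sum_(w in S) load h w)%N.
Proof.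
elim/last_ind: h => [|h q IH] H; first by rewrite leq0n.
rewrite -cats1 count_cat /= addn0 cats1.
under eq_bigr do rewrite load_rcons.
rewrite big_split /= leq_add //.
  by apply: IH => r rh; apply: H; rewrite mem_rcons inE rh orbT.
case pq: (p q) => //=.
rewrite (bigD1 q.2) /= ?eqxx //.
by apply: H; rewrite // mem_rcons inE eqxx.
Qed.

End Process.

(** * Balls of the graph *)

Lemma card_bigcup_le (I T : finType) (P : pred I) (F : I -> {set T}) :
  (#|\bigcup_(i | P i) F i| <= \sum_(i | P i) #|F i|)%N.
Proof.
elim/big_rec2: _ => [|i n A _ le_n]; first by rewrite cards0.
by apply: leq_trans (leq_card_setU _ _) _; rewrite leq_add2l.
Qed.

Section Balls.
Variables (T : finType) (e : rel T).
Hypothesis esym : symmetric e.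

Lemma gball_le u j k : (j <= k)%N -> gball e u j \subset gball e u k.
Proof.
move=> le_jk; apply/subsetP => v /gballP[p [pp pl sp]].
by apply/gballP; exists p; rewrite (leq_trans sp).
Qed.

Lemma gball_trans u v w j k : v \in gball e u j -> w \in gball e v k ->
  w \in gball e u (j + k).
Proof.
move=> /gballP[p [pp pl sp]] /gballP[q [qp ql sq]].
apply/gballP; exists (p ++ q).
by rewrite cat_path last_cat size_cat pp pl qp ql leq_add.
Qed.

Lemma gball_neighbour u w k : e u w -> w \in gball e u k.+1.
Proof. by move=> uw; apply/gballP; exists [:: w]; rewrite /= uw. Qed.

Lemma gball_sym u v k : (v \in gball e u k) = (u \in gball e v k).
Proof.
suff imp y z : y \in gball e z k -> z \in gball e y k by apply/idP/idP => /imp.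
move=> /gballP[p [pp pl sp]]; apply/gballP; exists (rev (belast z p)).
rewrite size_rev size_belast; split=> //.
  by rewrite -pl rev_path; apply: sub_path pp => a b; rewrite esym.
by case: p pl {pp sp} => [|a p] //=; rewrite rev_cons last_rcons.
Qed.

Lemma gball0 u : gball e u 0 = [set u].
Proof.
apply/setP => v; rewrite in_set1; apply/idP/eqP => [|->]; last exact: gball_center.
by move=> /gballP[[|a p] [] //].
Qed.

Lemma card_gball_gt0 u k : (0 < #|gball e u k|)%N.
Proof. by apply/card_gt0P; exists u; apply: gball_center. Qed.

Lemma gballS u k :
  gball e u k.+1 \subset \bigcup_(w in gball e u k) (w |: neighbours e w).
Proof.
apply/subsetP => v /gballP[p]; case/lastP: p => [|p z].
  by case=> _ <- _; apply/bigcupP; exists u; rewrite ?gball_center ?setU11.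
rewrite rcons_path last_rcons size_rcons ltnS => -[/andP[pp pz] <- sp].
apply/bigcupP; exists (last u p); first by apply/gballP; exists p.
by rewrite !inE pz orbT.
Qed.

Lemma card_gball_le Delta u k : (max_degree e <= Delta)%N ->
  (#|gball e u k| <= Delta.+1 ^ k)%N.
Proof.
move=> deg; elim: k => [|k IH]; first by rewrite gball0 cards1.
apply: leq_trans (subset_leq_card (gballS u k)) _.
apply: leq_trans (card_bigcup_le _ _) _.
rewrite expnSr (leq_trans _ (leq_mul IH (leqnn _))) // -sum_nat_const.
apply: leq_sum => w _; apply: leq_trans (leq_card_setU _ _) _.
rewrite cards1 add1n ltnS; apply: leq_trans deg.
exact: (@leq_bigmax _ (fun w => #|neighbours e w|)).
Qed.

Lemma gball_automorphism (s : {perm T}) u k : automorphism e s ->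
  s @: gball e u k \subset gball e (s u) k.
Proof.
move=> aut; apply/subsetP => _ /imsetP[v /gballP[p [pp pl sp]] ->].
apply/gballP; exists (map s p); rewrite size_map last_map pl; split=> //.
by rewrite path_map; apply: sub_path pp => a b /=; rewrite aut.
Qed.

Lemma card_gball_transitive u v k :
  vertex_transitive e -> #|gball e u k| = #|gball e v k|.
Proof.
move=> vt; suff le y z : (#|gball e y k| <= #|gball e z k|)%N.
  by apply/eqP; rewrite eqn_leq !le.
have [s aut <-] := vt y z.
by rewrite -(card_imset _ (@perm_inj _ s)) subset_leq_card ?gball_automorphism.
Qed.

(* Truncation at [D] keeps the distance finite across components.             *)
Definition trunc_dist D v w := find (fun r => w \in gball e v r) (iota 0 D).

Lemma trunc_dist_leD D v w : (trunc_dist D v w <= D)%N.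
Proof. by rewrite -[X in (_ <= X)%N](size_iota 0) find_size. Qed.

Lemma trunc_dist_le D v w k : (k < D)%N ->
  (trunc_dist D v w <= k)%N = (w \in gball e v k).
Proof.
move=> lt_k; apply/idP/idP => [le_k|wk].
  have lt_D := leq_ltn_trans le_k lt_k; apply: (subsetP (gball_le v le_k)).
  have hasD : has (fun r => w \in gball e v r) (iota 0 D).
    by rewrite has_find size_iota.
  by have := nth_find 0%N hasD; rewrite nth_iota // add0n.
rewrite leqNgt; apply/negP => /(before_find 0%N) /=.
by rewrite nth_iota // add0n wk.
Qed.

Lemma trunc_dist_lipschitz D v y z : e y z ->
  (trunc_dist D v y <= trunc_dist D v z + 1)%N.
Proof.
move=> yz; have [lt_D|] := ltnP (trunc_dist D v z + 1) D; last first.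
  by apply: leq_trans; apply: trunc_dist_leD.
rewrite trunc_dist_le //; apply: (@gball_trans v z); last first.
  by rewrite gball_neighbour // esym.
by rewrite -(@trunc_dist_le D) // (leq_trans _ lt_D) // addn1.
Qed.

Lemma alloc_prob_gball (R : realType) (x : T -> nat) u w k : (x u <= k)%N ->
  alloc_prob R e x u w != 0 -> w \in gball e u k.
Proof.
move=> le_k /(search_prob_lipschitz (@trunc_dist_lipschitz k.+1 w)).
have /eqP-> : trunc_dist k.+1 w w == 0%N.
  by rewrite -leqn0 trunc_dist_le ?gball_center.
rewrite add0n gball_sym -(@trunc_dist_le k.+1) // => le.
by apply: leq_trans le_k; apply: leq_trans le; rewrite leq_addr.
Qed.

Lemma lipschitz_gball (x : T -> nat) u v k :
  (forall y z, e y z -> (x y <= x z + 1)%N) ->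
  v \in gball e u k -> (x u <= x v + k)%N.
Proof.
move=> lip /gballP[p [pp <- sp]].
suff: (x u <= x (last u p) + size p)%N by lia.
elim: p u pp {sp} => [|a p IH] u /=; first by rewrite addn0.
by move=> /andP[/lip ua /IH]; lia.
Qed.

Lemma ex_packing k : exists Z : {set T},
  {in Z &, forall y z, y != z -> [disjoint gball e y k & gball e z k]} /\
  forall u, exists2 z, z \in Z & u \in gball e z (k + k).
Proof.
pose P (Z : {set T}) := [forall y in Z, forall z in Z,
  (y != z) ==> [disjoint gball e y k & gball e z k]].
have PP (Z : {set T}) : reflect {in Z &, forall y z, y != z ->
    [disjoint gball e y k & gball e z k]} (P Z).
  apply: (iffP forall_inP) => [H y z yZ zZ|H y yZ].
    by have /forall_inP/(_ z zZ)/implyP := H y yZ.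
  by apply/forall_inP => z zZ; apply/implyP; apply: H.
have P0 : P set0 by apply/PP => y z; rewrite inE.
have [Z /maxsetP[PZ maxZ] _] := maxset_exists P0.
exists Z; split=> [|u]; first exact/PP.
have near z v : v \in gball e u k -> v \in gball e z k ->
    u \in gball e z (k + k).
  by move=> vu vz; apply: gball_trans vz _; rewrite gball_sym.
have [uZ|nuZ] := boolP (u \in Z).
  by exists u => //; apply: gball_center.
(* If the ball of [u] met none of the chosen balls, [u] could be added to the maximal packing. *)
have /existsP[z /andP[zZ]] :
    [exists z, (z \in Z) && ~~ [disjoint gball e u k & gball e z k]].
  apply: contraR nuZ => /existsPn far.
  have disj z : z \in Z -> [disjoint gball e u k & gball e z k].
    by move=> zZ; have := far z; rewrite zZ negbK.
  rewrite -(maxZ (u |: Z)) ?setU11 ?subsetUr //; apply/PP => y z.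
  rewrite !inE => /predU1P[->|yZ] /predU1P[->|zZ]; rewrite ?eqxx //.
  - by move=> _; apply: disj.
  - by move=> _; rewrite disjoint_sym; apply: disj.
  - by apply/PP: yZ zZ.
by case/pred0Pn => v /= /andP[vu vz]; exists z => //; apply: near vu vz.
Qed.

Lemma card_le_packing (Z : {set T}) k b :
  (forall u, exists2 z, z \in Z & u \in gball e z k) ->
  (forall z, z \in Z -> #|gball e z k| <= b)%N -> (#|T| <= #|Z| * b)%N.
Proof.
move=> cover le_b; rewrite -cardsT.
have sub : [set: T] \subset \bigcup_(z in Z) gball e z k.
  by apply/subsetP => u _; have [z zZ uz] := cover u; apply/bigcupP; exists z.
apply: leq_trans (subset_leq_card sub) _; apply: leq_trans (card_bigcup_le _ _) _.
by rewrite -sum_nat_const; apply: leq_sum.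
Qed.

End Balls.

(** * The cone potential *)

Lemma expR_sub1_le (R : realType) (y z : R) : 0 <= z -> 0 <= y <= 1 ->
  expR (z * y) <= 1 + z * expR z * y.
Proof.
move=> z0 /andP[y0 y1].
have H : 1 - z * y <= expR (- (z * y)) := expR_ge1Dx _.
have le_e : expR (z * y) <= expR z by rewrite ler_expR ler_piMr.
have : (1 - z * y) * expR (z * y) <= 1.
  apply: le_trans (ler_wpM2r (expR_ge0 _) H) _.
  by rewrite -expRD addNr expR0.
have : z * y * expR (z * y) <= z * y * expR z by rewrite ler_wpM2l ?mulr_ge0.
by lra.
Qed.

Section Potential.
Variable R : realType.
Variables (b : R) (h0 : nat).
Hypothesis b_gt1 : 1 < b.

(* The value of the [j]-th ball on a vertex at distance [d] from the apex;    *)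
(* the cut-off at [j = d] makes vertices farther away than the maximum load   *)
(* irrelevant.                                                                *)
Definition weight (d j : nat) : R :=
  if (d <= j)%N then b^-1 ^+ (h0 - (j - d)) else 0.

Let b_gt0 : 0 < b. Proof. exact: lt_trans b_gt1. Qed.
Let bV_itv : 0 <= b^-1 <= 1.
Proof. by rewrite invr_ge0 ltW //= invf_le1 // ltW. Qed.
Let bV_ge0 : 0 <= b^-1. Proof. by case/andP: bV_itv. Qed.

Lemma weight_ge0 d j : 0 <= weight d j.
Proof. by rewrite /weight; case: ifP => // _; rewrite exprn_ge0. Qed.

Lemma weight_le1 d j : weight d j <= 1.
Proof. by rewrite /weight; case: ifP => // _; rewrite exprn_ile1 //; case/andP: bV_itv. Qed.

Lemma weight_homo d j d' j' : (d' + j <= d + j')%N -> weight d j <= weight d' j'.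
Proof.
rewrite /weight => le; case: ifP => [le_d|_]; last exact: weight_ge0.
rewrite ifT; last by lia.
by apply: ler_wiXn2l; [case/andP: bV_itv | case/andP: bV_itv | lia].
Qed.

Lemma weight_eq1 d j : (h0 + d <= j)%N -> weight d j = 1.
Proof.
move=> le; rewrite /weight ifT; last by lia.
by have /eqP-> : (h0 - (j - d))%N == 0%N by lia.
Qed.

(** Successive weights on a vertex grow by a factor of at most [b], so as for a geometric series the
    next one is at most [b - 1] times the sum of the earlier ones, plus a starting term. *)
Lemma weight_le_sum d x : weight d x.+1 <=
  (b - 1) * (\sum_(i < x) weight d i.+1) + b * b^-1 ^+ h0.
Proof.
have bb : b * b^-1 = 1 by rewrite divff ?gt_eqF.
have bX k : b^-1 ^+ k <= b * b^-1 ^+ k.+1.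
  by rewrite exprS mulrA bb mul1r.
have first_le : b^-1 ^+ h0 <= b * b^-1 ^+ h0.
  by rewrite ler_peMl ?exprn_ge0 // ltW.
have last_ge0 : 0 <= b * b^-1 ^+ h0 by rewrite mulr_ge0 ?exprn_ge0 // ltW.
have b1_ge0 : 0 <= b - 1 by rewrite subr_ge0 ltW.
elim: x => [|x IH].
  rewrite big_ord0 mulr0 add0r /weight; case: ifP => [|_]; last first.
    by rewrite mulr_ge0 ?exprn_ge0 // ltW.
  case: d => [|[|d]] // _; rewrite ?subn0 ?subnn ?subn0 //.
  case: h0 => [|h] //=; first by rewrite expr0 mulr1 ltW.
  by rewrite subSS subn0 bX.
have S0 : 0 <= \sum_(i < x) weight d i.+1.
  by apply: sumr_ge0 => i _; apply: weight_ge0.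
rewrite big_ord_recr /= mulrDr; case: (ltngtP d x.+2) => [lt_d|gt_d|eq_d].
- suff: weight d x.+2 <= b * weight d x.+1 by move: IH; rewrite mulrBl; lra.
  rewrite /weight !ifT //; last by lia.
  have [le|lt] := leqP h0 (x.+1 - d).
    have /eqP-> : (h0 - (x.+2 - d))%N == 0%N by lia.
    have /eqP-> : (h0 - (x.+1 - d))%N == 0%N by lia.
    by rewrite expr0 mulr1 ltW.
  have -> : (h0 - (x.+1 - d) = (h0 - (x.+2 - d)).+1)%N by lia.
  exact: bX.
- have -> : weight d x.+2 = 0 by rewrite /weight leqNgt gt_d.
  by apply: addr_ge0 => //; rewrite -mulrDr mulr_ge0 // addr_ge0 ?weight_ge0.
- have -> : weight d x.+2 = b^-1 ^+ h0 by rewrite /weight eq_d leqnn subnn subn0.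
  apply: le_trans first_le _; rewrite lerDr -mulrDr mulr_ge0 //.
  by rewrite addr_ge0 ?weight_ge0.
Qed.

Variables (T : finType) (d : T -> nat) (N : nat).

(** The constant, times [b - 1], pays for the starting terms of [weight_le_sum] at [N] vertices;
    this makes the growth rate proportional to the potential itself. *)
Definition potential (x : T -> nat) : R :=
  N%:R * (b * b^-1 ^+ h0) / (b - 1) +
  \sum_w \sum_(i < x w) weight (d w) i.+1.

Lemma potential_ge x (A : {set T}) k j : (forall w, w \in A -> (d w <= j)%N) ->
  (forall w, w \in A -> (h0 + j + k <= x w)%N) ->
  k%:R * #|A|%:R <= potential x.
Proof.
move=> le_j le_x; rewrite /potential -[X in X <= _]add0r lerD //.
  by rewrite divr_ge0 ?subr_ge0 ?mulr_ge0 ?exprn_ge0 // ltW.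
have S0 w : 0 <= \sum_(i < x w) weight (d w) i.+1.
  by apply: sumr_ge0 => i _; apply: weight_ge0.
rewrite (bigID (fun w => w \in A)) /= -[X in X <= _]addr0 lerD //; last by apply: sumr_ge0 => w _; exact: S0.
rewrite mulr_natr -sumr_const; apply: ler_sum => w wA.
rewrite -(big_mkord xpredT (fun i => weight (d w) i.+1)).
rewrite (@big_cat_nat _ _ _ (h0 + j)) //=; last first.
  by apply: leq_trans (le_x _ wA); rewrite leq_addr.
rewrite (@big_cat_nat _ _ _ (h0 + j + k) (h0 + j)) ?le_x ?leq_addr //=.
rewrite addrCA -[X in X <= _]addr0 lerD //; last first.
  by rewrite addr_ge0 //; apply: sumr_ge0 => i _; apply: weight_ge0.
rewrite big_nat (eq_bigr (fun=> 1)) => [|i /andP[le_i _]].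
  by rewrite -big_nat sumr_const_nat addKn.
by rewrite weight_eq1 // (leq_trans _ (leqW le_i)) // leq_add2l le_j.
Qed.

Lemma potential_rcons (h : seq (T * T)) p :
  potential (load (rcons h p)) =
  potential (load h) + weight (d p.2) (load h p.2).+1.
Proof.
rewrite /potential -addrA; congr (_ + _).
rewrite (bigD1 p.2) //= [in RHS](bigD1 p.2) //= load_rcons eqxx addn1.
rewrite big_ord_recr /= -!addrA; congr (_ + _); rewrite [RHS]addrC; congr (_ + _).
by apply: eq_bigr => w nw; rewrite load_rcons eq_sym (negPf nw) addn0.
Qed.

Lemma weight_le_potential x l : (forall u, (x u < l)%N) ->
  (#|[set u | (d u <= l)%N]| <= N)%N ->
  \sum_u weight (d u) (x u).+1 <= (b - 1) * potential x.
Proof.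
move=> lt_l le_N; rewrite /potential mulrDr mulrC divfK ?gt_eqF ?subr_gt0 //.
set S := [set u | _] in le_N.
have le_NS : #|S|%:R * (b * b^-1 ^+ h0) <= N%:R * (b * b^-1 ^+ h0).
  by rewrite ler_wpM2r ?ler_nat // mulr_ge0 ?exprn_ge0 // ltW.
apply: le_trans (lerD le_NS (lexx _)).
have -> : #|S|%:R * (b * b^-1 ^+ h0) =
    \sum_u if u \in S then b * b^-1 ^+ h0 else 0.
  by rewrite -big_mkcond sumr_const mulr_natl.
rewrite big_distrr -big_split /=; apply: ler_sum => u _; rewrite inE; case: ifP => [_|nS].
  by rewrite addrC weight_le_sum.
(* Beyond distance [l] the next ball still lies below the cut-off. *)
have -> : weight (d u) (x u).+1 = 0.
  by rewrite /weight ifF //; have := lt_l u; lia.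
rewrite add0r mulr_ge0 ?subr_ge0 ?(ltW b_gt1) //.
by apply: sumr_ge0 => i _; apply: weight_ge0.
Qed.

(** A ball is worth at most what it would be on top of its uniform birthplace, so the expected
    increase is at most [(b - 1) / n] times the potential. The factor [expR th0] is the price of
    linearising the exponential. *)
Lemma potential_step (e : rel T) (h : seq (T * T)) l (th th0 : R) :
  (forall y z, e y z -> (d y <= d z + 1)%N) ->
  (forall u, (load h u < l)%N) ->
  (#|[set u | (d u <= l)%N]| <= N)%N -> 0 <= th <= th0 -> (0 < #|T|)%N ->
  #|T|%:R^-1 * \sum_u \sum_w alloc_prob R e (load h) u w *
    expR (th * potential (load (rcons h (u, w)))) <=
  expR (th * (1 + (b - 1) * expR th0 / #|T|%:R) * potential (load h)).
Proof.
move=> lip lt_l le_N /andP[th_ge0 le_th] T0; set x := load h.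
have n0 : 0 < #|T|%:R :> R by rewrite ltr0n.
pose E := expR (th * potential x).
apply: le_trans (_ : #|T|%:R^-1 * \sum_u
    E * (1 + th * expR th * weight (d u) (x u).+1) <= _).
  apply: ler_wpM2l; first by rewrite invr_ge0 ltW.
  apply: ler_sum => u _; rewrite -[X in _ <= X]mul1r.
  rewrite -[X in _ <= X * _](alloc_prob_sum R e x u) mulr_suml; apply: ler_sum => w _.
  have [->|nz] := eqVneq (alloc_prob R e x u w) 0; first by rewrite !mul0r.
  apply: ler_wpM2l; first exact: alloc_prob_ge0.
  rewrite potential_rcons mulrDr expRD; apply: ler_wpM2l; first exact: expR_ge0.
  apply: le_trans (_ : expR (th * weight (d u) (x u).+1) <= _).
    rewrite ler_expR ler_wpM2l // weight_homo //= !addnS ltnS.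
    exact: search_prob_lipschitz lip nz.
  by rewrite expR_sub1_le // weight_ge0 weight_le1.
pose W := \sum_u weight (d u) (x u).+1.
have -> : #|T|%:R^-1 * \sum_u E * (1 + th * expR th * weight (d u) (x u).+1) =
    E * (1 + #|T|%:R^-1 * (th * expR th * W)).
  rewrite -mulr_sumr big_split /= sumr_const -mulr_sumr -/W.
  by field; rewrite gt_eqF.
have le_W : W <= (b - 1) * potential x := weight_le_potential lt_l le_N.
have -> : th * (1 + (b - 1) * expR th0 / #|T|%:R) * potential x =
    th * potential x +
    #|T|%:R^-1 * (th * expR th0 * ((b - 1) * potential x)).
  by field; rewrite gt_eqF.
rewrite expRD; apply: ler_wpM2l; first exact: expR_ge0.
apply: le_trans (expR_ge1Dx _); rewrite lerD2l ler_wpM2l ?invr_ge0 ?ler0n //.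
apply: ler_pM => //; first by rewrite mulr_ge0 ?expR_ge0.
  by apply: sumr_ge0 => u _; apply: weight_ge0.
by rewrite ler_wpM2l // ler_expR.
Qed.

End Potential.

(** * The maximum load, and its upper tail for a given decay ratio *)

Section MaxLoad.
Variables (T : finType).
Implicit Types (h : seq (T * T)).

Lemma max_loadP h l : reflect (forall u, (load h u <= l)%N) (max_load h <= l)%N.
Proof.
apply: (iffP (bigmax_leqP _ _ _)) => H u; first exact: H.
by move=> _; apply: H.
Qed.

Lemma load_le_max_load h u : (load h u <= max_load h)%N.
Proof. by move: u; apply/max_loadP. Qed.

Lemma max_load_nil : max_load (T := T) [::] = 0%N.
Proof. by apply/eqP; rewrite -leqn0; apply/max_loadP. Qed.

Lemma max_load_rcons h p :
  (max_load h <= max_load (rcons h p) <= (max_load h).+1)%N.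
Proof.
apply/andP; split; apply/max_loadP => u.
  by apply: leq_trans (load_le_max_load (rcons h p) u); rewrite load_rcons leq_addr.
by rewrite load_rcons -addn1 leq_add ?load_le_max_load ?leq_b1.
Qed.

Lemma ex_max_load h : (0 < #|T|)%N -> exists v, load h v = max_load h.
Proof. by move=> T0; have [v eq_v] := bigop.eq_bigmax (load h) T0; exists v. Qed.

End MaxLoad.

(** When a vertex first reaches load [8 s], its ball of radius [s] has loads of at least
    [7 s = 4 s + s + 2 s]: cone height, distance to the apex, and [2 s] balls of value 1 on each
    vertex. The factor [n] is a union bound over apexes. *)
Lemma Prob_max_load_ge (R : realType) (T : finType) (e : rel T) (s N Y : nat)
    (b th0 : R) :
  symmetric e -> 1 < b -> 0 <= th0 -> (0 < s)%N -> (0 < #|T|)%N ->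
  (forall v, #|gball e v (8 * s)| <= N)%N ->
  (forall v, Y <= #|gball e v s|)%N ->
  Prob R e (fun h : #|T|.-tuple (T * T) => (8 * s <= max_load h)%N) <=
  #|T|%:R * expR (th0 * (N%:R * (b * b^-1 ^+ (4 * s)) / (b - 1) -
    expR (- ((b - 1) * expR th0)) * (2 * s * Y)%:R)).
Proof.
move=> esym b_gt1 th0_ge0 s_gt0 T0 le_N le_Y.
set m := #|T|; set kap := (b - 1) * expR th0; set l := (8 * s)%N.
have m0 : 0 < m%:R :> R by rewrite ltr0n.
have kap_ge0 : 0 <= kap by rewrite mulr_ge0 ?expR_ge0 // subr_ge0 ltW.
pose a : R := 1 + kap / m%:R.
have a_ge1 : 1 <= a by rewrite lerDl divr_ge0 // ltW.
have a_gt0 : 0 < a by apply: lt_le_trans a_ge1.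
have aV_itv : 0 <= a^-1 <= 1 by rewrite invr_ge0 ltW //= invf_le1.
(* With [k] balls to come; one step of [potential_step] turns [th k] into at most [th k.+1]. *)
pose th k := th0 * a^-1 ^+ (m - k).
pose pot v := potential b (4 * s) (trunc_dist e l.+1 v) N.
pose y : R := (2 * s * Y)%:R.
(* Freezing at 1 stops the process once the load [l] is reached, since [potential_step] needs loads
   below [l]. *)
pose Phi k (h : seq (T * T)) : R := if (l <= max_load h)%N then 1 else
  \sum_v expR (th k * pot v (load h) - th 0%N * y).
have th_ge0 k : 0 <= th k by rewrite mulr_ge0 // exprn_ge0 //; case/andP: aV_itv.
have th_le k : th k <= th0.
  by rewrite ler_piMr // exprn_ile1 //; case/andP: aV_itv.
have thS k : (k < m)%N -> th k * a = th k.+1.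
  move=> lt_k; rewrite /th -mulrA; congr (_ * _).
  have -> : (m - k = (m - k.+1).+1)%N by lia.
  by rewrite exprSr -mulrA mulVf ?gt_eqF // mulr1.
have sum_ge0 k h : 0 <= \sum_v expR (th k * pot v (load h) - th 0%N * y).
  by apply: sumr_ge0 => v _; apply: expR_ge0.
have th_homo k : th 0%N <= th k.
  rewrite ler_wpM2l //; case/andP: aV_itv => a0 a1.
  by apply: ler_wiXn2l => //; rewrite leq_sub.
have y_ge0 : 0 <= y by rewrite ler0n.
have Phi_le k h : feasible R e h -> (max_load h <= l)%N ->
    Phi k h <= \sum_v expR (th k * pot v (load h) - th 0%N * y).
  move=> fh le_l; rewrite /Phi; case: ifP => // ge_l.
  have [v loadv] := ex_max_load h T0.
  rewrite (bigD1 v) //= -[X in X <= _]addr0 lerD ?sumr_ge0 //; last first.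
    by move=> w _; apply: expR_ge0.
  rewrite -[X in X <= _]expR0 ler_expR subr_ge0.
  have y_le : y <= pot v (load h).
    apply: le_trans (_ : (2 * s)%:R * #|gball e v s|%:R <= _).
      by rewrite -natrM ler_nat leq_mul.
    apply: (@potential_ge _ _ _ b_gt1 _ _ _ _ _ _ s) => w wS.
      by rewrite trunc_dist_le // /l; lia.
    have := lipschitz_gball (load_lipschitz esym fh) wS.
    by rewrite loadv; lia.
  by apply: ler_pM.
apply: le_trans (_ : Phi m [::] <= _).
  apply: Prob_le_supermartingale => [k h|h _ ge_l|k h lt_k fh].
  - by rewrite /Phi; case: ifP.
  - by rewrite /Phi ge_l.
  have n0 : 0 <= #|T|%:R^-1 :> R by rewrite invr_ge0 ler0n.
  rewrite [X in _ <= X]/Phi; case: ifP => [ge_l|lt_l].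
    rewrite (eq_bigr (fun=> 1)) => [|u _].
      by rewrite sumr_const mulVf // gt_eqF.
    rewrite -[RHS](alloc_prob_sum R e (load h) u); apply: eq_bigr => w _.
    rewrite /Phi ifT ?mulr1 //; apply: leq_trans ge_l _.
    by have /andP[] := max_load_rcons h (u, w).
  have {}lt_l : (max_load h < l)%N by rewrite ltnNge lt_l.
  apply: le_trans (_ : \sum_v #|T|%:R^-1 * \sum_u \sum_w
      alloc_prob R e (load h) u w *
      expR (th k * pot v (load (rcons h (u, w)))) * expR (- (th 0%N * y)) <= _).
    rewrite -mulr_sumr; apply: ler_wpM2l => //.
    rewrite [X in _ <= X]exchange_big; apply: ler_sum => u _ /=.
    rewrite [X in _ <= X]exchange_big; apply: ler_sum => w _ /=.
    have [->|nz] := eqVneq (alloc_prob R e (load h) u w) 0.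
      by rewrite mul0r big1 // => v _; rewrite !mul0r.
    under eq_bigr do rewrite -mulrA -expRD.
    rewrite -mulr_sumr ler_wpM2l ?alloc_prob_ge0 //; apply: Phi_le.
      by apply/feasible_rcons.
    by have /andP[_ le] := max_load_rcons h (u, w); apply: leq_trans le lt_l.
  apply: ler_sum => v _; rewrite expRD.
  under eq_bigr do rewrite -mulr_suml.
  rewrite -mulr_suml mulrA ler_wpM2r ?expR_ge0 // -thS //.
  apply: (@potential_step _ _ _ b_gt1 _ _ _ _ _ l) => //.
  - exact: trunc_dist_lipschitz.
  - by move=> u; apply: leq_ltn_trans lt_l; apply: load_le_max_load.
  - rewrite (leq_trans _ (le_N v)) // subset_leq_card //.
    by apply/subsetP => u; rewrite inE trunc_dist_le.
  - by rewrite th_ge0 th_le.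
rewrite /Phi max_load_nil ifF; last by rewrite /l; lia.
rewrite mulr_natl -sumr_const; apply: ler_sum => v _; rewrite ler_expR.
rewrite /th subnn expr0 mulr1 subn0 mulrBr lerB //.
  rewrite ler_wpM2l // /pot /potential big1 ?addr0 // => w _.
  by rewrite big_ord0.
rewrite mulrA ler_wpM2r // ler_wpM2l // exprVn expRN lef_pV2 ?posrE ?expR_gt0 ?exprn_gt0 //.
have -> : kap = m%:R * (kap / m%:R) by rewrite mulrC divfK ?gt_eqF.
by rewrite expRM_natl lerXn2r ?nnegrE ?expR_ge0 ?expR_ge1Dx // ltW.
Qed.

(** * Upper bound in terms of the radius *)

Lemma Prob_subset (R : realType) (T : finType) (e : rel T) m
    (A B : pred (m.-tuple (T * T))) :
  (forall h, A h -> B h) -> Prob R e A <= Prob R e B.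
Proof.
move=> AB; rewrite /Prob big_mkcond [X in _ <= X]big_mkcond.
apply: ler_sum => h _; case: ifP => [/AB->//|_].
by case: ifP => // _; apply: outcome_prob_ge0.
Qed.

Lemma bernoulli (R : realDomainType) (x : R) n :
  0 <= x -> 1 + n%:R * x <= (1 + x) ^+ n.
Proof.
move=> x0; elim: n => [|n IH]; first by rewrite mul0r addr0 expr0.
rewrite exprS -natr1; have : 0 <= n%:R * x * x by rewrite !mulr_ge0 ?ler0n.
have := ler_wpM2l (_ : 0 <= 1 + x) IH; rewrite addr_ge0 // => /(_ isT).
by lra.
Qed.

Lemma expRN1_ge (R : realType) : 4%:R^-1 <= expR (-1) :> R.
Proof.
have e2 : (2%:R^-1 : R) <= expR (- 2%:R^-1).
  by apply: le_trans (expR_ge1Dx _); lra.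
have -> : -1 = - 2%:R^-1 + - 2%:R^-1 :> R by lra.
by rewrite expRD (le_trans _ (ler_pM _ _ e2 e2)) //; lra.
Qed.

Lemma R1P (R : realType) (T : finType) (e : rel T) : (0 < R1 e R)%N /\
  forall u, ln (#|T|%:R : R) <=
    (R1 e R)%:R * #|gball e u (R1 e R)|%:R * ln (R1 e R)%:R.
Proof.
by rewrite /R1; case: ex_minnP => r /andP[r0 /forallP adm] _.
Qed.

(* The cone through a vertex of load [8 s] has at least [2 s Y] balls of      *)
(* value 1, and here volume growth is moderate enough to let the value decay  *)
(* at the slow rate [b = 1 + s^(-1/2)]; this gains the factor [ln s].         *)
Lemma Prob_max_load_ge_moderate (R : realType) (T : finType) (e : rel T)
    (s N Y : nat) :
  symmetric e -> (0 < s)%N -> (0 < #|T|)%N -> (N <= s * Y)%N ->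
  (forall v, #|gball e v (8 * s)| <= N)%N ->
  (forall v, Y <= #|gball e v s|)%N ->
  Prob R e (fun h : #|T|.-tuple (T * T) => (8 * s <= max_load h)%N) <=
  #|T|%:R * expR (- ((s * Y)%:R * ln s%:R / 12%:R)).
Proof.
move=> esym s_gt0 T0 le_NsY le_N le_Y.
have s0 : 0 < s%:R :> R by rewrite ltr0n.
have s1 : 1 <= s%:R :> R by rewrite ler1n.
(* Here [q] is the square root of [s]; the exponent [t] makes [(b - 1) * expR t] equal to 1. *)
pose t : R := ln s%:R / 2%:R; pose q := expR t.
have q0 : 0 < q by apply: expR_gt0.
have qq : q * q = s%:R.
  rewrite -expRD [X in expR X](_ : _ = ln s%:R); last by rewrite /t; lra.
  by rewrite lnK ?posrE.
have t0 : 0 <= t by rewrite divr_ge0 ?ln_ge0.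
pose b := 1 + q^-1.
have b1 : 1 < b by rewrite ltrDl invr_gt0.
apply: le_trans (Prob_max_load_ge esym b1 t0 s_gt0 T0 le_N le_Y) _.
rewrite ler_wpM2l ?ler0n // ler_expR.
have -> : (b - 1) * expR t = 1 by rewrite /b addrAC subrr add0r mulVf ?gt_eqF.
set c := N%:R * _ / _.
have b0 : 0 < b by apply: lt_trans b1.
have c_le : c <= (s * Y)%:R / 3%:R.
  have -> : c = N%:R * (q * (b * b^-1 ^+ (4 * s))).
    by rewrite /c /b addrAC subrr add0r invrK; ring.
  rewrite ler_pM ?ler_nat // ?mulr_ge0 ?exprn_ge0 ?invr_ge0 ?(ltW q0) ?(ltW b0) //.
  rewrite exprVn mulrA lter_pdivrMr ?exprn_gt0 //.
  have -> : (4 * s = (4 * s).-1.+1)%N by lia.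
  rewrite exprS [q * b]mulrC mulrCA ler_pM2l //.
  rewrite ler_pdivlMl ?ltr0n //.
  apply: le_trans (_ : (1 + q^-1) ^+ (3 * s) <= _); last first.
    by rewrite ler_weXn2l ?(ltW b1) //; lia.
  apply: le_trans (bernoulli _ _); last by rewrite invr_ge0 ltW.
  by rewrite natrM -qq -!mulrA divff ?gt_eqF // mulr1 lerDr.
have e4 := expRN1_ge R.
have sY0 : 0 <= (s * Y)%:R :> R by rewrite ler0n.
have gap : c - expR (-1) * (2 * s * Y)%:R <= - ((s * Y)%:R / 6%:R).
  have : 4%:R^-1 * (s * Y)%:R <= expR (-1) * (s * Y)%:R :=
    ler_wpM2r sY0 e4.
  by rewrite -mulnA natrM; lra.
apply: le_trans (ler_wpM2l t0 gap) _.
by rewrite /t; lra.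
Qed.

(** With this [b], the power [b^(4 s)] equals the bound [(Delta + 2)^(8 s)] on the ball volume, so
    the initial potential is at most 2 whatever the growth. *)
Lemma Prob_max_load_ge_large (R : realType) (T : finType) (e : rel T)
    (Delta s Y : nat) :
  let b : R := Delta.+2%:R ^+ 2 in
  symmetric e -> (max_degree e <= Delta)%N -> (0 < s)%N -> (0 < #|T|)%N ->
  (forall v, Y <= #|gball e v s|)%N ->
  Prob R e (fun h : #|T|.-tuple (T * T) => (8 * s <= max_load h)%N) <=
  #|T|%:R * expR (2%:R - expR (- ((b - 1) * expR 1)) * (2 * s * Y)%:R).
Proof.
move=> b esym deg s_gt0 T0 le_Y.
have g2 : 2%:R <= Delta.+2%:R :> R by rewrite ler_nat.
have b4 : 4%:R <= b.
  by rewrite /b expr2 (le_trans _ (ler_pM _ _ g2 g2)) ?ler0n //; lra.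
have b1 : 1 < b by lra.
have b0 : 0 < b by lra.
have le_N v : (#|gball e v (8 * s)| <= Delta.+2 ^ (8 * s))%N.
  by apply: leq_trans (card_gball_le _ _ deg) _; rewrite leq_exp2r //; lia.
apply: le_trans (Prob_max_load_ge esym b1 ler01 s_gt0 T0 le_N le_Y) _.
rewrite ler_wpM2l ?ler0n // ler_expR mul1r lerB //.
rewrite natrX (_ : (8 * s = 2 * (4 * s))%N); last by lia.
rewrite exprM -/b mulrCA exprVn divff ?mulr1; last first.
  by rewrite gt_eqF ?exprn_gt0.
by rewrite ler_pdivrMr; lra.
Qed.

Lemma max_load_upper (R : realType) (Delta : nat) : exists K : nat, (0 < K)%N /\
  forall (T : finType) (e : rel T), symmetric e -> vertex_transitive e ->
    (max_degree e <= Delta)%N -> (0 < #|T|)%N ->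
    Prob R e (fun h : #|T|.-tuple (T * T) => (K * R1 e R <= max_load h)%N) <=
    #|T|%:R * expR (- (3%:R * ln #|T|%:R)).
Proof.
pose kap : R := (Delta.+2%:R ^+ 2 - 1) * expR 1.
pose A := (Num.Def.archi_bound (expR kap)).+1.
have leA : 1 <= expR (- kap) * A%:R.
  rewrite expRN mulrC ler_pdivlMr ?expR_gt0 // mul1r ltW //.
  apply: lt_le_trans (archi_boundP (expR_ge0 _)) _.
  by rewrite ler_nat.
exists (8 * (8 * 36 * A))%N; split=> // T e esym vt deg T0.
have [r0 adm] := R1P R e; set r := R1 e R in r0 adm *.
set L := ln _ in adm *; pose s := (36 * r)%N.
have [v0 _] : exists v : T, true by have /card_gt0P[v _] := T0; exists v.
pose Y := #|gball e v0 s|; pose N := #|gball e v0 (8 * s)|.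
have s_gt0 : (0 < s)%N by rewrite muln_gt0.
have L0 : 0 <= L by rewrite ln_ge0 // ler1n.
have Y_gt0 : (0 < Y)%N by apply: card_gball_gt0.
have lnr0 : 0 <= ln r%:R :> R by rewrite ln_ge0 // ler1n.
have adm' : L <= r%:R * Y%:R * ln r%:R.
  apply: le_trans (adm v0) _; rewrite ler_wpM2r // ler_wpM2l ?ler0n // ler_nat.
  by rewrite subset_leq_card // gball_le //; rewrite /s; lia.
have ball_eq k v : #|gball e v k| = #|gball e v0 k|.
  exact: card_gball_transitive.
have [le_N|gt_N] := leqP N (s * Y).
  apply: le_trans (_ : Prob R e (fun h : #|T|.-tuple (T * T) =>
    (8 * s <= max_load h)%N) <= _).
    by apply: Prob_subset => h; apply: leq_trans; rewrite /s; lia.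
  apply: le_trans (Prob_max_load_ge_moderate R esym s_gt0 T0 le_N _ _) _.
  - by move=> v; rewrite ball_eq.
  - by move=> v; rewrite ball_eq.
  rewrite ler_wpM2l ?ler0n // ler_expR lerN2.
  have lnrs : ln r%:R <= ln s%:R :> R.
    by rewrite ler_ln ?posrE ?ltr0n // ler_nat /s; lia.
  have : r%:R * Y%:R * ln r%:R <= r%:R * Y%:R * ln s%:R :> R.
    by rewrite ler_wpM2l // mulr_ge0 ?ler0n.
  by rewrite natrM /s [(36 * r)%:R]natrM; lra.
(* A ball of radius [s2] contains one of radius [8 s], of more than [s * Y] vertices. This extra
   factor [s] outweighs the missing logarithm, and [A] cancels [expR (- kap)]. *)
pose s2 := (8 * s * A)%N.
apply: le_trans (_ : Prob R e (fun h : #|T|.-tuple (T * T) =>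
  (8 * s2 <= max_load h)%N) <= _).
  by apply: Prob_subset => h; apply: leq_trans; rewrite /s2 /s; lia.
have s2_gt0 : (0 < s2)%N by rewrite !muln_gt0 r0.
have le_N v : (N <= #|gball e v s2|)%N.
  by rewrite ball_eq subset_leq_card // gball_le // leq_pmulr.
apply: le_trans (Prob_max_load_ge_large R esym deg s2_gt0 T0 le_N) _.
rewrite ler_wpM2l ?ler0n // ler_expR -/kap.
have lnr : ln r%:R <= r%:R :> R by rewrite ltW // ln_sublinear // ltr0n.
have sN1 : 1 <= (s * N)%:R :> R by rewrite ler1n muln_gt0 s_gt0 card_gball_gt0.
have sNL : L <= (s * N)%:R.
  apply: le_trans adm' _; apply: le_trans (_ : r%:R * Y%:R * r%:R <= _).
    by rewrite ler_wpM2l // mulr_ge0 ?ler0n.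
  rewrite -!natrM ler_nat; apply: leq_trans (_ : s * (s * Y) <= _)%N.
    by rewrite [(r * Y)%N]mulnC -mulnA mulnC mulnA !leq_mul // /s; lia.
  by rewrite leq_mul2l (ltnW gt_N) orbT.
have : 1 * (16 * (s * N))%:R <= expR (- kap) * A%:R * (16 * (s * N))%:R :> R.
  by rewrite ler_wpM2r ?ler0n.
have -> : (2 * s2 * N)%:R = A%:R * (16 * (s * N))%:R :> R.
  by rewrite -natrM; congr _%:R; rewrite /s2; lia.
by rewrite [in X in X -> _]natrM; lra.
Qed.

(** * Births in disjoint sets *)

Section BinomialTail.
Variables (R : realType) (q : R).
Hypothesis q_itv : 0 <= q <= 1.

(* The probability that a binomial variable of parameters [k], [q] is [< a].  *)
Fixpoint lower_tail (k a : nat) : R :=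
  if k is k'.+1 then q * lower_tail k' a.-1 + (1 - q) * lower_tail k' a
  else (0 < a)%:R.

Let q0 : 0 <= q. Proof. by case/andP: q_itv. Qed.
Let q1 : 0 <= 1 - q. Proof. by rewrite subr_ge0; case/andP: q_itv. Qed.

Lemma lower_tail0 k : lower_tail k 0 = 0.
Proof. by elim: k => //= k ->; rewrite !mulr0 addr0. Qed.

Lemma lower_tail_ge0 k a : 0 <= lower_tail k a.
Proof. by elim: k a => [|k IH] a /=; rewrite ?ler0n // addr_ge0 ?mulr_ge0. Qed.

Lemma lower_tail_pred k a : lower_tail k a.-1 <= lower_tail k a.
Proof.
elim: k a => [|k IH] a /=; last by rewrite lerD // ler_wpM2l.
by case: a => [|[|a]] //=; rewrite ler01.
Qed.

(** The right side is at least the probability of exactly [a] successes, with the power of [1 - q]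
    enlarged from [k - a] to [k]. *)
Lemma lower_tail_le k a :
  'C(k, a)%:R * q ^+ a * (1 - q) ^+ k <= 1 - lower_tail k a.
Proof.
have q1_le : 1 - q <= 1 by rewrite gerBl.
elim: k a => [|k IH] [|a].
- by rewrite bin0 /= subr0 !mulr1.
- by rewrite bin_small //= subrr !mul0r.
- by rewrite bin0 lower_tail0 subr0 !mul1r exprn_ile1.
rewrite binS natrD /= !exprS.
have := ler_wpM2l q0 (IH a); have := ler_wpM2l q1 (IH a.+1).
rewrite exprS; set C1 := 'C(k, a.+1)%:R; set C0 := 'C(k, a)%:R.
set Q := q ^+ a; set P := (1 - q) ^+ k => le1 le0.
have : 0 <= q * (C0 * Q * P) * q.
  by rewrite !mulr_ge0 ?exprn_ge0 ?ler0n.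
move: le1 le0; set t := lower_tail k a.+1; set t0 := lower_tail k a.
have -> : (1 - q) * (C1 * (q * Q) * P) = C1 * q * Q * (1 - q) * P by ring.
have -> : q * (C0 * Q * P) * q = q * (C0 * Q * P) - C0 * q * Q * (1 - q) * P.
  by ring.
have -> : (C1 + C0) * (q * Q) * ((1 - q) * P) =
  C1 * q * Q * (1 - q) * P + C0 * q * Q * (1 - q) * P by ring.
rewrite mulrBr mulr1 [X in _ <= X -> _]mulrBr mulr1.
by lra.
Qed.

End BinomialTail.

(* A step of the proof that occupation numbers of disjoint sets are           *)
(* negatively associated.                                                     *)
Lemma sum_prod_disjoint_le (R : realFieldType) (T I : finType) (s : seq I)
    (S : I -> {set T}) (g dl : I -> R) :
  uniq s -> {in s &, forall y z, y != z -> [disjoint S y & S z]} ->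
  (forall z, 0 <= dl z <= g z) -> (0 < #|T|)%N ->
  \sum_u \prod_(z <- s) (g z - (u \in S z)%:R * dl z) <=
  #|T|%:R * \prod_(z <- s) (g z - #|S z|%:R / #|T|%:R * dl z).
Proof.
move=> s_uniq disj dl_itv T0.
have n0 : 0 < #|T|%:R :> R by rewrite ltr0n.
have g_ge0 z : 0 <= g z by have /andP[/le_trans] := dl_itv z; apply.
elim: s s_uniq disj => [|z s IH] /=.
  by move=> _ _; rewrite big_nil mulr1 (eq_bigr (fun=> 1)) ?sumr_const // => u _;
     rewrite big_nil.
move=> /andP[z_s s_uniq] disj; rewrite big_cons.
have {}IH := IH s_uniq (fun x y xs ys =>
  disj x y (mem_behead (s := z :: s) xs) (mem_behead (s := z :: s) ys)).
pose F u := \prod_(y <- s) (g y - (u \in S y)%:R * dl y).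
pose G := \prod_(y <- s) g y.
pose P := \prod_(y <- s) (g y - #|S y|%:R / #|T|%:R * dl y).
have frac y : 0 <= (#|S y|%:R / #|T|%:R : R) <= 1.
  by rewrite divr_ge0 ?ler0n //= ler_pdivrMr // mul1r ler_nat max_card.
have P_le : P <= G.
  rewrite /P /G big_seq [X in _ <= X]big_seq; apply: ler_prod => y _.
  have /andP[f0 f1] := frac y; have /andP[d0 dg] := dl_itv y.
  rewrite subr_ge0 gerBl mulr_ge0 // andbT (le_trans _ dg) //.
  by rewrite ler_piMl.
have FG u : u \in S z -> F u = G.
  move=> uz; rewrite /F /G !(big_seq_cond predT); apply: eq_bigr => y /andP[ys _].
  have yz : y != z by apply: contraNneq z_s => <-.
  have := disj y z; rewrite !inE ys eqxx orbT /= => /(_ isT isT yz).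
  by move=> /disjointFl ->; rewrite // mul0r subr0.
rewrite (eq_bigr (fun u => g z * F u - (if u \in S z then dl z * G else 0))).
  rewrite big_split /= sumrN -mulr_sumr -big_mkcond sumr_const -/P.
  have := ler_wpM2l (g_ge0 z) IH; rewrite -/P => le1.
  have /andP[d0 _] := dl_itv z.
  have : #|S z|%:R * dl z * P <= #|S z|%:R * dl z * G.
    by rewrite ler_wpM2l // mulr_ge0 ?ler0n.
  rewrite -[X in _ -> _ - X <= _]mulr_natl => le2.
  have -> : #|T|%:R * ((g z - #|S z|%:R / #|T|%:R * dl z) * P) =
    g z * (#|T|%:R * P) - #|S z|%:R * dl z * P by field; rewrite gt_eqF.
  by rewrite mulrA; apply: lerB.
move=> u _; rewrite big_cons -/(F u); case: ifP => uz.
  by rewrite FG // mul1r; ring.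
by rewrite mul0r !subr0.
Qed.

Lemma Prob_births_lt (R : realType) (T : finType) (e : rel T) m
    (A : pred (m.-tuple (T * T))) (Z : {set T}) (S : T -> {set T}) (sz K : nat) :
  (0 < #|T|)%N ->
  {in Z &, forall y z, y != z -> [disjoint S y & S z]} ->
  (forall z, #|S z| = sz) ->
  (forall h : m.-tuple (T * T), feasible R e h -> A h ->
    forall z, (count (fun p => p.1 \in S z) h < K)%N) ->
  Prob R e A <= lower_tail (sz%:R / #|T|%:R) m K ^+ #|Z|.
Proof.
move=> T0 disj cardS births_lt; set q : R := sz%:R / #|T|%:R.
have n0 : 0 < #|T|%:R :> R by rewrite ltr0n.
have q_itv : 0 <= q <= 1.
  rewrite divr_ge0 ?ler0n //= ler_pdivrMr // mul1r ler_nat.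
  by have /card_gt0P[z _] := T0; rewrite -(cardS z) max_card.
pose births z (h : seq (T * T)) := count (fun p => p.1 \in S z) h.
(* The chance that all counts end below [K] if from now on they were independent binomials. *)
pose Phi k h := \prod_(z <- enum Z) lower_tail q k (K - births z h).
have -> : lower_tail q m K ^+ #|Z| = Phi m [::].
  rewrite /Phi big_enum /= -prodr_const; apply: eq_bigr => z _.
  by rewrite subn0.
apply: Prob_le_supermartingale => [k h|h fh Ah|k h _ _].
- by apply: prodr_ge0 => z _; apply: lower_tail_ge0.
- rewrite /Phi big1 //= => z _.
  by have := births_lt h fh Ah z; rewrite -subn_gt0 /births => ->.
under eq_bigr => u _.
  under eq_bigr => w _.
    rewrite (_ : Phi k (rcons h (u, w)) = Phi k (rcons h (u, u))); last first.
      by apply: eq_bigr => z _; rewrite /births -!cats1 !count_cat.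
    over.
  rewrite -mulr_suml alloc_prob_sum mul1r.
  over.
rewrite mulrC ler_pdivrMr // mulrC.
pose g z := lower_tail q k (K - births z h).
pose g' z := lower_tail q k (K - births z h).-1.
have := @sum_prod_disjoint_le R T T (enum Z) S g (fun z => g z - g' z)
  (enum_uniq _) _ _ T0.
have gP z : 0 <= g z - g' z <= g z.
  by rewrite subr_ge0 lower_tail_pred //= gerBl lower_tail_ge0.
move=> /(_ _ gP) H.
apply: le_trans (le_trans (H _) _).
- apply: ler_sum => u _; rewrite le_eqVlt; apply/orP; left; apply/eqP.
  apply: eq_bigr => z _; rewrite /births -cats1 count_cat /= addn0 subnDA.
  rewrite /g /g' /births; case: (u \in S z); last by rewrite subn0 mul0r subr0.
  by rewrite subn1 mul1r subKr.
- by move=> y z; rewrite !mem_enum; apply: disj.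
rewrite ler_wpM2l ?ler0n // le_eqVlt; apply/orP; left; apply/eqP.
apply: eq_bigr => z _; rewrite cardS -/q /= /g /g'; ring.
Qed.

(** * Lower bound in terms of the radius *)

Lemma expn_le_bin n k : (k <= n -> n ^ k <= 'C(n, k) * k ^ k)%N.
Proof.
elim: n k => [|n IH] [|k] // le_kn; rewrite ?bin0 //.
have [->|k_gt0] := posnP k; first by rewrite bin1 !expn1 muln1.
rewrite ltnS in le_kn; have {}IH := IH k le_kn.
have kk_gt0 : (0 < k ^ k)%N by rewrite expn_gt0 k_gt0.
rewrite [X in (_ <= _ * X)%N]expnS mulnA [X in (_ <= X * _)%N]mulnC.
rewrite -mul_bin_diag expnS -mulnA leq_pmul2l // -(leq_pmul2r kk_gt0) mulnAC.
apply: leq_trans (leq_mul IH (leqnn _)).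
by rewrite -!expnMn leq_exp2r //; lia.
Qed.

Lemma lower_tail_le_expR (R : realType) (n sz k : nat) : (0 < k)%N ->
  (k <= n)%N -> (2 * sz <= n)%N ->
  (sz%:R / k%:R) ^+ k * expR (- (2 * sz)%:R) <=
    1 - lower_tail (sz%:R / n%:R : R) n k.
Proof.
move=> k_gt0 le_kn le_szn; set q : R := sz%:R / n%:R.
have k0 : 0 < k%:R :> R by rewrite ltr0n.
have n0 : 0 < n%:R :> R by rewrite ltr0n (leq_trans k_gt0).
have q_ge0 : 0 <= q by rewrite divr_ge0 ?ler0n.
have q_half : q <= 2%:R^-1.
  by rewrite ler_pdivrMr // ler_pdivlMl // -natrM ler_nat.
have q_itv : 0 <= q <= 1 by rewrite q_ge0 /=; lra.
apply: le_trans (lower_tail_le q_itv n k); apply: ler_pM => //.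
- by rewrite exprn_ge0 // divr_ge0 ?ler0n.
- by rewrite expR_ge0.
- rewrite !expr_div_n mulrCA ler_wpM2l ?exprn_ge0 ?ler0n //.
  rewrite -div1r ler_pdivrMr ?exprn_gt0 // mulrAC ler_pdivlMr ?exprn_gt0 // mul1r.
  by rewrite -!natrX -natrM ler_nat expn_le_bin.
have -> : - (2 * sz)%:R = n%:R * - (2%:R * q).
  by rewrite natrM /q; field; rewrite gt_eqF.
rewrite expRM_natl lerXn2r ?nnegrE ?expR_ge0 //; first by lra.
have e_ge : 1 + 2%:R * q <= expR (2%:R * q) := expR_ge1Dx _.
rewrite expRN -div1r ler_pdivrMr ?expR_gt0 //.
apply: le_trans (ler_wpM2l (_ : 0 <= 1 - q) e_ge); last by lra.
have : 0 <= q * (1 - 2%:R * q) by rewrite mulr_ge0 //; lra.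
by lra.
Qed.

(** A ball moves at most as often as the load of its birthplace, so these balls all land within
    radius [s + l], where each vertex holds fewer than [l]. *)
Lemma births_lt (R : realType) (T : finType) (e : rel T) (h : seq (T * T)) z s l :
  symmetric e -> feasible R e h -> (max_load h < l)%N ->
  (count (fun p => p.1 \in gball e z s) h < l * #|gball e z (s + l)|)%N.
Proof.
move=> esym fh lt_l.
have ends q : q \in h -> q.1 \in gball e z s -> q.2 \in gball e z (s + l).
  move=> /path.splitPr eq_h qz; apply: (gball_trans qz).
  case: eq_h fh lt_l => h1 h2 fh lt_l.
  apply: (alloc_prob_gball esym _ (fh h1 q h2 erefl)).
  apply: leq_trans (ltnW lt_l); apply: leq_trans (load_le_max_load _ q.1).
  by rewrite /load /unzip2 map_cat count_cat leq_addr.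
apply: leq_ltn_trans (sum_load_le ends) _.
apply: leq_ltn_trans (_ : #|gball e z (s + l)| * max_load h < _)%N.
  by rewrite -sum_nat_const; apply: leq_sum => w _; apply: load_le_max_load.
by rewrite mulnC ltn_pmul2r ?card_gball_gt0.
Qed.

Lemma Prob_max_load_lt (R : realType) (T : finType) (e : rel T) (v0 : T)
    (s l : nat) (p : R) :
  symmetric e -> vertex_transitive e -> 0 <= p ->
  p <= 1 - lower_tail (#|gball e v0 s|%:R / #|T|%:R) #|T|
             (l * #|gball e v0 (s + l)|) ->
  Prob R e (fun h : #|T|.-tuple (T * T) => (max_load h < l)%N) <=
  expR (- (p * #|T|%:R / #|gball e v0 (s + s)|%:R)).
Proof.
move=> esym vt p_ge0 le_p.
have T0 : (0 < #|T|)%N by apply/card_gt0P; exists v0.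
have [Z [disj cover]] := ex_packing esym s.
have le_Z := card_le_packing cover
  (fun z _ => eq_leq (card_gball_transitive z v0 (s + s) vt)).
set K := (l * _)%N in le_p; set q := _ / _ in le_p.
have q_itv : 0 <= q <= 1.
  by rewrite divr_ge0 ?ler0n //= ler_pdivrMr ?ltr0n // mul1r ler_nat max_card.
apply: le_trans (@Prob_births_lt _ _ e _ _ Z (gball e ^~ s) #|gball e v0 s| K
  T0 disj _ _) _.
- by move=> z; apply: card_gball_transitive.
- move=> h fh lt_l z; rewrite /K -(card_gball_transitive z v0 _ vt).
  exact: births_lt esym fh lt_l.
apply: le_trans (_ : expR (- p) ^+ #|Z| <= _).
  rewrite lerXn2r ?nnegrE ?lower_tail_ge0 ?expR_ge0 //.
  by apply: le_trans (expR_ge1Dx _); lra.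
rewrite -expRM_natl ler_expR mulrN lerN2 -mulrA [X in _ <= X]mulrC ler_wpM2l //.
by rewrite ler_pdivrMr ?ltr0n ?card_gball_gt0 // -natrM ler_nat.
Qed.

(* If the volume grows by at most a factor [l] from radius [l] to [2 l], a    *)
(* surplus of births in a ball of radius [l] is cheap enough; otherwise the   *)
(* ball of radius [2 l] is so large that even placing all births at its       *)
(* centre is.                                                                 *)
Lemma ex_concentrating_radius (R : realType) (T : finType) (e : rel T) (v : T)
    (Delta l : nat) :
  let L : R := ln #|T|%:R in
  symmetric e -> (max_degree e <= Delta)%N -> (0 < l)%N ->
  1 <= ln l%:R :> R -> ln Delta.+1%:R <= ln l%:R :> R ->
  16%:R * (l * #|gball e v (2 * l)|)%:R * ln l%:R <= L ->
  exists2 s, (s <= l)%N & expR (- (L / 4%:R)) <=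
    1 - lower_tail (#|gball e v s|%:R / #|T|%:R) #|T| (l * #|gball e v (s + l)|).
Proof.
move=> L esym deg l_gt0 lnl1 lnD; set b2 := #|gball e v (2 * l)| => small.
have T0 : (0 < #|T|)%N by apply/card_gt0P; exists v.
set M := (l * b2)%N in small; set x : R := ln l%:R in lnl1 lnD small *.
have x_ge0 : 0 <= x by lra.
have l0 : 0 < l%:R :> R by rewrite ltr0n.
have expRx : expR x = l%:R by rewrite lnK ?posrE.
have Mx : M%:R <= M%:R * x by rewrite ler_peMr.
have leL : L <= #|T|%:R by rewrite ltW // ln_sublinear // ltr0n.
have le_M : (16 * M <= #|T|)%N.
  by rewrite -(ler_nat R) natrM; lra.
have b2_gt0 : (0 < b2)%N by apply: card_gball_gt0.
have M_gt0 : (0 < M)%N by rewrite muln_gt0 l_gt0.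
set b1 := #|gball e v l|.
have b1_gt0 : (0 < b1)%N by apply: card_gball_gt0.
have le_b : (b1 <= b2)%N by rewrite subset_leq_card // gball_le //; lia.
have le_bM : (b2 <= M)%N by rewrite leq_pmull.
have [le_b2|gt_b2] := leqP b2 (l * b1).
  exists l => //; rewrite addnn -mul2n -/b2 -/M -/b1.
  apply: le_trans (lower_tail_le_expR R M_gt0 _ _); try lia.
  apply: le_trans (_ : expR (- (2%:R * x)) ^+ M * expR (- (2 * b1)%:R) <= _).
    rewrite -expRM_natl -expRD ler_expR natrM.
    have : b1%:R <= M%:R :> R by rewrite ler_nat; lia.
    by lra.
  rewrite ler_wpM2r ?expR_ge0 // lerXn2r ?nnegrE ?expR_ge0 ?divr_ge0 ?ler0n //.
  rewrite ler_pdivlMr ?ltr0n // mulrC expRN -div1r mulrA ler_pdivrMr ?expR_gt0 //.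
  have -> : 2%:R * x = x + x by lra.
  rewrite expRD expRx mulr1 -!natrM ler_nat /M.
  by rewrite [(b1 * _)%N]mulnC -mulnA leq_mul2l le_b2 orbT.
exists 0%N => //; rewrite add0n gball0 cards1 -/b1; set K := (l * b1)%N.
have K_gt0 : (0 < K)%N by rewrite muln_gt0 l_gt0.
have K_le : (K <= M)%N by rewrite leq_mul2l le_b orbT.
apply: le_trans (lower_tail_le_expR R K_gt0 _ _); try lia.
(* Since [Delta + 1] is at most [l], the ball of radius [l] has at most [l^l] vertices, so [K] is at
   most [l * l^l = expR y]. *)
pose y : R := x + l%:R * x.
have y_ge0 : 0 <= y by rewrite addr_ge0 // mulr_ge0 // ltW.
have K_exp : K%:R <= expR y.
  rewrite expRD expRx expRM_natl expRx /K natrM ler_wpM2l ?ler0n //.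
  rewrite -natrX ler_nat; apply: leq_trans (card_gball_le v l deg) _.
  rewrite leq_exp2r //.
  by rewrite -(ler_nat R) -ler_ln ?posrE ?ltr0n.
have Ky : K%:R * y <= 2%:R * (M%:R * x).
  have K_b2 : K%:R * l%:R <= M%:R :> R.
    by rewrite -natrM ler_nat /M mulnC leq_mul2l (ltnW gt_b2) orbT.
  have : K%:R * l%:R * x <= M%:R * x by rewrite ler_wpM2r.
  have : K%:R * x <= M%:R * x by rewrite ler_wpM2r // ler_nat.
  by rewrite /y; lra.
apply: le_trans (_ : expR (- y) ^+ K * expR (- (2 * 1)%:R) <= _).
  have M1 : 1 <= M%:R :> R by rewrite ler1n.
  by rewrite -expRM_natl -expRD ler_expR; lra.
rewrite ler_wpM2r ?expR_ge0 // lerXn2r ?nnegrE ?expR_ge0 ?divr_ge0 ?ler0n //.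
by rewrite expRN mul1r lef_pV2 ?posrE ?expR_gt0 ?ltr0n.
Qed.

Lemma R1_lt (R : realType) (T : finType) (e : rel T) r :
  (0 < r)%N -> (r < R1 e R)%N ->
  exists u, r%:R * #|gball e u r|%:R * ln r%:R < ln (#|T|%:R : R).
Proof.
rewrite /R1; case: ex_minnP => r1 _ min_r1 r0 lt_r.
have /forallPn[u nadm] : ~~ [forall u : T, ln (#|T|%:R : R) <=
    r%:R * #|gball e u r|%:R * ln (r%:R : R)].
  apply/negP => adm; have := min_r1 r; rewrite /R1_admissible r0 adm => /(_ isT).
  by rewrite leqNgt lt_r.
by exists u; rewrite ltNge.
Qed.

Lemma R1_gt (R : realType) (T : finType) (e : rel T) (Delta r : nat) :
  symmetric e -> (max_degree e <= Delta)%N -> (0 < #|T|)%N ->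
  (r * Delta.+1 ^ r * r)%:R < ln (#|T|%:R : R) -> (r < R1 e R)%N.
Proof.
move=> esym deg /card_gt0P[v _]; rewrite ltnNge; apply: contraTN => le_r.
have [r1_gt0 /(_ v) adm] := R1P R e; rewrite -leNgt.
apply: le_trans adm _; set r1 := R1 e R in le_r r1_gt0 *.
have lnr1 : ln r1%:R <= r1%:R :> R by rewrite ltW // ln_sublinear // ltr0n.
apply: le_trans (ler_wpM2l _ lnr1) _; first by rewrite mulr_ge0.
rewrite -!natrM ler_nat !leq_mul //.
apply: leq_trans (card_gball_le v r1 deg) _.
by rewrite leq_pexp2l.
Qed.

Lemma max_load_lower (R : realType) (Delta : nat) : exists n0 : nat,
  forall (T : finType) (e : rel T), symmetric e -> vertex_transitive e ->
    (max_degree e <= Delta)%N -> (n0 <= #|T|)%N ->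
    Prob R e (fun h : #|T|.-tuple (T * T) => (32 * max_load h < R1 e R)%N) <=
    expR (- (2%:R * ln #|T|%:R)).
Proof.
pose l0 := Delta.+4; pose r0 := (16 * l0)%N.
(* The first summand forces [R1] above [r0] through [R1_gt]; 128 is what the cubic estimate at the
   end requires. *)
pose B : R := (r0 * Delta.+1 ^ r0 * r0)%:R + 128%:R.
exists (Num.Def.archi_bound (expR B)) => T e esym vt deg le_n.
have B_lt : expR B < #|T|%:R.
  apply: lt_le_trans (archi_boundP (expR_ge0 _)) _; first by rewrite ler_nat.
have n_pos : 0 < #|T|%:R :> R by apply: lt_trans B_lt; apply: expR_gt0.
have T0 : (0 < #|T|)%N by rewrite -(ltr0n R).
set L := ln _; have expL : expR L = #|T|%:R by rewrite lnK ?posrE.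
have {B_lt} B_lt : B < L by rewrite -ltr_expR expL.
have r0_ge0 : 0 <= (r0 * Delta.+1 ^ r0 * r0)%:R :> R by rewrite ler0n.
have L128 : 128%:R <= L by rewrite /B in B_lt; lra.
have lt_r : (r0 < R1 e R)%N.
  by apply: R1_gt esym deg T0 _; rewrite -/L; rewrite /B in B_lt; lra.
(* The 16 gives the slack of [ex_concentrating_radius] from the inadmissible radius [r.-1]; rounding
   then costs at most [r <= 32 * l]. *)
set r := R1 e R in lt_r *; pose l := (r.-1 %/ 16)%N.
have l_ge : (l0 <= l)%N by rewrite /l /r0 in lt_r *; lia.
have l_le : (16 * l <= r.-1)%N by rewrite /l; lia.
have r_le : (r <= 32 * l)%N by rewrite /l /l0 in l_ge *; lia.
have r1_gt0 : (0 < r.-1)%N by rewrite /l0 in l_ge; lia.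
have [v not_adm] := R1_lt (e := e) (R := R) r1_gt0 (ltac:(lia) : (r.-1 < r)%N).
have l_gt0 : (0 < l)%N by apply: leq_trans l_ge.
have le_ln (i j : nat) : (0 < i)%N -> (i <= j)%N -> ln i%:R <= ln j%:R :> R.
  move=> i0 le_ij; rewrite ler_ln ?posrE ?ltr0n ?(leq_trans i0) //.
  by rewrite ler_nat.
have lnl : 1 <= ln l%:R :> R.
  apply: le_trans (le_ln 4%N l isT (leq_trans _ l_ge)) => //.
  rewrite -ler_expR lnK ?posrE ?ltr0n //.
  have := expRN1_ge R; rewrite expRN lef_pV2 ?posrE ?expR_gt0 ?ltr0n //.
have lnD : ln Delta.+1%:R <= ln l%:R :> R.
  by apply: le_ln => //; apply: leq_trans l_ge; rewrite /l0; lia.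
set b2 := #|gball e v (2 * l)|.
have small : 16%:R * (l * b2)%:R * ln l%:R <= L.
  apply: le_trans (ltW not_adm); rewrite -!natrM; apply: ler_pM => //.
  - by lra.
  - rewrite ler_nat mulnA leq_mul //.
    by rewrite subset_leq_card // gball_le //; lia.
  - by apply: le_ln => //; lia.
have [s le_s le_p] := ex_concentrating_radius esym deg l_gt0 lnl lnD small.
rewrite -/L in le_p.
apply: le_trans (_ : Prob R e (fun h : #|T|.-tuple (T * T) =>
  (max_load h < l)%N) <= _).
  apply: Prob_subset => h lt_h.
  by rewrite -(@ltn_pmul2l 32) // (leq_trans lt_h r_le).
apply: le_trans (Prob_max_load_lt esym vt (expR_ge0 _) le_p) _.
rewrite ler_expR lerN2.
have b2_gt0 : (0 < b2)%N by apply: card_gball_gt0.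
have b2_le : b2%:R <= L.
  apply: le_trans small; apply: le_trans (_ : (l * b2)%:R <= _).
    by rewrite ler_nat leq_pmull.
  have lb2 : 0 <= (l * b2)%:R :> R by rewrite ler0n.
  have : (l * b2)%:R <= (l * b2)%:R * ln l%:R :> R by rewrite ler_peMr.
  by lra.
have bs_le : #|gball e v (s + s)|%:R <= L.
  apply: le_trans b2_le; rewrite ler_nat subset_leq_card // gball_le //.
  by rewrite mul2n -addnn leq_add.
have bs_gt0 : 0 < #|gball e v (s + s)|%:R :> R by rewrite ltr0n card_gball_gt0.
rewrite ler_pdivlMr // -expL -expRD.
apply: le_trans (_ : 2%:R * L * L <= _).
  by rewrite ler_wpM2l //; lra.
have -> : - (L / 4%:R) + L = 3%:R * (L / 4%:R) by lra.
have le_e : 1 + L / 4%:R <= expR (L / 4%:R) := expR_ge1Dx _.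
(* It remains to see that [n^(3/4)] exceeds [2 L^2], and [(L / 4)^3] already does once [L] is at
   least 128. *)
rewrite expRM_natl; apply: le_trans (_ : (L / 4%:R) ^+ 3 <= _); last first.
  by rewrite lerXn2r ?nnegrE ?expR_ge0 //; lra.
have : 0 <= L ^+ 2 * (L - 128%:R) by rewrite mulr_ge0 ?exprn_ge0 //; lra.
have -> : (L / 4%:R) ^+ 3 = L ^+ 2 * (L - 128%:R) / 64%:R + 2%:R * L * L.
  by field.
by lra.
Qed.

Theorem theorem1p1 (R : realType) (Delta : nat) :
  exists (c C : R) (n0 : nat), [/\ 0 < c, 0 < C &
    forall (T : finType) (e : rel T),
      symmetric e -> irreflexive e -> vertex_transitive e ->
      (n0 <= #|T|)%N -> (max_degree e <= Delta)%N ->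
      1 - #|T|%:R^-1 <=
        Prob R e (fun h : #|T|.-tuple (T * T) =>
          c * (R1 e R)%:R <= (max_load h)%:R <= C * (R1 e R)%:R)].
Proof.
have [K [K_gt0 upper]] := max_load_upper R Delta.
have [n1 lower] := max_load_lower R Delta.
(* From [n >= 2] on, the two tails of [n^(-2)] add up to at most [n^(-1)]. *)
exists (32%:R^-1), K%:R, (maxn 2 n1); split; rewrite ?invr_gt0 ?ltr0n //.
move=> T e esym _ vt; rewrite geq_max => /andP[n_ge2 n_ge1] deg.
have T0 : (0 < #|T|)%N by apply: leq_trans n_ge2.
have n0 : 0 < #|T|%:R :> R by rewrite ltr0n.
have {upper} up := upper T e esym vt deg T0.
have {lower} low := lower T e esym vt deg n_ge1.
set r := R1 e R in up low *; set n : R := #|T|%:R in n0 up low *.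
pose good (h : #|T|.-tuple (T * T)) : bool :=
  32%:R^-1 * r%:R <= ((max_load h)%:R : R) <= K%:R * r%:R.
set P := Prob R e _ in low; set Q := Prob R e _ in up.
have total : Prob R e (m := #|T|) predT <= Prob R e good + (P + Q).
  rewrite /P /Q /Prob [X in _ <= X + _]big_mkcond.
  rewrite [X in _ <= _ + (X + _)]big_mkcond [X in _ <= _ + (_ + X)]big_mkcond.
  rewrite -!big_split.
  apply: ler_sum => h _ /=; have := outcome_prob_ge0 R e h.
  set pr := outcome_prob R e h => pr0.
  case: ifP => [_|]; first by rewrite lerDl addr_ge0 //; case: ifP.
  move/negbT; rewrite negb_and -!ltNge => bad.
  case: ifP => lt_low; first by rewrite add0r lerDl; case: ifP.
  case: ifP => lt_up; first by rewrite !add0r.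
  move: bad; rewrite ltr_pdivlMl ?ltr0n // -!natrM !ltr_nat lt_low /=.
  by move/ltnW; rewrite lt_up.
have exp2 : expR (- (2%:R * ln n)) = n^-1 * n^-1.
  by rewrite expRN expRM_natl lnK ?posrE // expr2 invfM.
have exp3 : n * expR (- (3%:R * ln n)) = n^-1 * n^-1.
  rewrite expRN expRM_natl lnK ?posrE //.
  by field; rewrite gt_eqF.
rewrite exp2 in low; rewrite exp3 in up.
have inv_le : n^-1 * n^-1 <= 2%:R^-1 * n^-1.
  by rewrite ler_pM2r ?invr_gt0 // lef_pV2 ?posrE ?ltr0n // ler_nat.
rewrite -[X in _ <= X]/(Prob R e good).
rewrite Prob_total // in total; move: total low up; set Pg := Prob R e good.
by lra.
Qed.
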